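(* Let $\phi:\mathcal{L}\to\mathcal{L}'$ be a tame map between two finite lattices, let $\mathcal{B}$ be an $\mathcal{L}$-building set and $\mathcal{B}'$ an $\mathcal{L}'$-building set. If $\mathcal{B}=\phi^{-1}(\mathcal{B}')$ (or equivalently $\mathcal{B}'\cap\phi(\mathcal{L})=\phi(\mathcal{B})$), then $(\mathcal{B},\mathcal{B}')$ is $\phi$-compatible.
   Context: For a finite lattice $\mathcal{L}$ with bottom $\hat 0$, an $\mathcal{L}$-building set is a subset $\mathcal{B}\subseteq\mathcal{L}_{>\hat 0}$ such that for every $Y\in\mathcal{L}_{>\hat 0}$, with $\{B_1,\dots,B_k\}=\max(\mathcal{B}_{\le Y})$, there is a poset isomorphism $\prod_{j}\mathcal{L}_{\le B_j}\to\mathcal{L}_{\le Y}$ whose $j$-th component is the inclusion $\mathcal{L}_{\le B_j}\subseteq\mathcal{L}_{\le Y}$. Let $\kappa(\mathcal{B})=\max(\mathcal{B})$. An $\mathcal{L}$-nested set on $\mathcal{B}$ is a subset $\mathcal{N}\subseteq\mathcal{B}$ containing $\kappa(\mathcal{B})$ such that for any $k\ge2$ pairwise incomparable $B_1,\dots,B_k\in\mathcal{N}\setminus\kappa(\mathcal{B})$, the join $B_1\vee\cdots\vee B_k$ is not in $\mathcal{B}$. The $\mathcal{L}$-nested complex of $\mathcal{B}$ is the simplicial complex with faces $\mathcal{N}\setminus\kappa(\mathcal{B})$ for all $\mathcal{L}$-nested sets $\mathcal{N}$ on $\mathcal{B}$. An order embedding is a map $\phi:\mathcal{L}\to\mathcal{L}'$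 with $X\le Y\iff\phi(X)\le\phi(Y)$. The map $\phi$ is tame if it is an order embedding and satisfies at least one of the following: (atom exhaustive) $\phi(\mathcal{L})$ contains all atoms $a$ of $\mathcal{L}'$ with $a\le\phi(\hat 1_{\mathcal{L}})$; (join preserving) $\phi(X\vee Y)=\phi(X)\vee\phi(Y)$ for all $X,Y\in\mathcal{L}$; (cover preserving) $\phi$ sends cover relations of $\mathcal{L}$ to cover relations of $\mathcal{L}'$. For an order embedding $\phi$, the pair $(\mathcal{B},\mathcal{B}')$ is $\phi$-compatible if $\phi(\mathcal{B})\subseteq\mathcal{B}'$ and $\phi$ embeds the $\mathcal{L}$-nested complex of $\mathcal{B}$ as a subcomplex of the $\mathcal{L}'$-nested complex of $\mathcal{B}'$ (i.e. $\phi$ sends each face of the former to a face of the latter). *)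

(* Defs.v *)
From mathcomp Require Import all_boot all_order.

Set Implicit Arguments.
Unset Strict Implicit.
Unset Printing Implicit Defensive.

Import Order.TTheory.

Local Open Scope order_scope.

Section Lattice.

Context {d : Order.disp_t} {L : finTBLatticeType d}.
Implicit Types (x y Y : L) (A B N S : {set L}).

Definition cover_rel : rel L :=
  fun x y => (x < y) && [forall z : L, ~~ (x < z < y)].

Definition atom x : bool := cover_rel \bot x.

Definition max_elements A : {set L} :=
  [set b in A | [forall c in A, ~~ (b < c)]].

Definition interval_below Y : Type := {x : L | x <= Y}.

Definition factors B Y : {set L} := max_elements [set b in B | b <= Y].

Definition factor_product B Y : Type :=
  {dffun forall b : {b : L | b \in factors B Y}, interval_below (val b)}.

Definition factor_product_le B Y (u v : factor_product B Y) : Prop :=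
  forall b, val (u b) <= val (v b).

(* The condition that the component of f at b is the inclusion of
   [\bot, b] in [\bot, Y] reads: a family that is \bot away from b is sent
   to its entry at b. *)
Definition building_set B : Prop :=
  (forall b, b \in B -> \bot < b) /\
  (forall Y, \bot < Y ->
     exists f : factor_product B Y -> interval_below Y,
       [/\ bijective f,
           (forall u v : factor_product B Y,
              factor_product_le u v <-> val (f u) <= val (f v))
         & (forall (u : factor_product B Y) b,
              (forall c, c != b -> val (u c) = \bot) ->
              val (f u) = val (u b))]).

Definition kappa B : {set L} := max_elements B.

Definition antichain S : bool :=
  [forall x in S, forall y in S, (x != y) ==> (x >< y)].

(* Pairwise incomparable elements are distinct, so k >= 2 of them amount to
   an antichain S with 1 < #|S|. *)
Definition nested_set B N : bool :=
  [&& N \subset B,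
      kappa B \subset N
    & [forall S : {set L},
         [&& S \subset N :\: kappa B, (1 < #|S|)%N & antichain S] ==>
         (\join_(x in S) x \notin B)]].

Definition nested_complex B : {set {set L}} :=
  [set N :\: kappa B | N : {set L} & nested_set B N].

End Lattice.

Section Maps.

Context {d d' : Order.disp_t}.
Context {L : finTBLatticeType d} {L' : finTBLatticeType d'}.
Implicit Types (phi : L -> L').

Definition order_embedding phi : Prop :=
  forall X Y : L, X <= Y <-> phi X <= phi Y.

Definition atom_exhaustive phi : Prop :=
  forall a : L', atom a -> a <= phi \top -> exists X : L, phi X = a.

Definition join_preserving phi : Prop :=
  forall X Y : L, phi (X `|` Y) = phi X `|` phi Y.

Definition cover_preserving phi : Prop :=
  forall X Y : L, cover_rel X Y -> cover_rel (phi X) (phi Y).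

Definition tame phi : Prop :=
  order_embedding phi /\
  [\/ atom_exhaustive phi, join_preserving phi | cover_preserving phi].

(* Meant for phi an order embedding, hence injective. *)
Definition compatible phi (B : {set L}) (B' : {set L'}) : Prop :=
  phi @: B \subset B' /\
  (forall F : {set L}, F \in nested_complex B ->
     phi @: F \in nested_complex B').

End Maps.

(* Main.v *)
Require Import Defs.
From mathcomp Require Import all_boot all_order.

(** The hypothesis [B = phi @^-1: B'] reduces everything to one point: when S is
    an antichain of a face of the complex of B, with at least two elements, and
    Y is its join, the join J of [phi @: S] must avoid B'.  As Y is not in B,
    [phi Y] is not in B', so it suffices to rule out that J is in B' and
    J < [phi Y].

    A building set gives each interval [\bot, Y] coordinates [x `&` b], for b in
    the factors of Y ([building_join_factors], [building_meet_join]).  They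
    give the classical fact that the factors of the join of such an S lie in S
    ([factors_join_sub]): the elements of S below a factor b join to b, and two
    or more of them could not do so without breaking nestedness.  Moreover, an
    x in [\bot, Y] such that all y < x lie below one w, with x not below w, is
    itself below a factor, hence below a member of S ([irreducible_le_factor]).
    This applies to atoms, and to elements with a single lower cover.

    - If phi preserves joins, J = [phi Y] ([join_preserving_big]).

    - If phi preserves covers, again J = [phi Y] ([cover_preserving_big]):
      phi Z <= J for all Z <= Y, by induction on Z.  Indeed, if phi Z is not
      below J, the induction hypothesis puts the image of a lower cover of Z
      below [phi Z `&` J] < phi Z.  As phi Z covers this image, the image
      equals [phi Z `&` J].  Thus Z has only one lower cover, so it lies below
      a member of S, whose image is below J.

    - If phi exhausts atoms and J is in B', then J lies below one factor of
      [phi Y]; there is another factor, disjoint from the first, and an atom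
      below it is not below J ([building_missed_atom]).  But that atom is the
      image of \bot or of an atom below Y, hence of an element below a member
      of S, and this puts it below J ([atom_exhaustive_big]). *)

Set Implicit Arguments.
Unset Strict Implicit.
Unset Printing Implicit Defensive.

Import Order.TTheory.

Local Open Scope order_scope.

(** * Finite lattices *)

Section FiniteLattice.

Context {d : Order.disp_t} {L : finTBLatticeType d}.
Implicit Types (x y z Y : L) (A B S F : {set L}).

Lemma ltn_card_below x y : x < y ->
  (#|[set z : L | (z <= x)%O]| < #|[set z : L | (z <= y)%O]|)%N.
Proof.
move=> xy; apply: proper_card; apply/properP; split.
  by apply/subsetP => z; rewrite !inE => /le_trans; apply; apply: ltW.
by exists y; rewrite inE ?lexx // lt_geF.
Qed.

Lemma lt_wf_ind (P : L -> Prop) :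
  (forall x, (forall y, y < x -> P y) -> P x) -> forall x, P x.
Proof.
move=> IH x; have [n] := ubnP #|[set z : L | z <= x]|.
elim: n x => // n IHn x xn; apply: IH => y /ltn_card_below yx.
by apply: IHn; apply: leq_trans yx _.
Qed.

Lemma max_elements_above A x : x \in A -> exists2 m, m \in max_elements A & x <= m.
Proof.
move=> xA; pose r y := #|[set z : L | z <= y]|.
case: (@arg_maxnP _ x [pred y in A | x <= y] r) => [|m /andP[mA xm] m_max].
  by rewrite inE xA lexx.
exists m => //; rewrite inE mA; apply/forall_inP => c cA.
apply/negP => mc; have /m_max : [pred y in A | x <= y] c.
  by rewrite inE cA (le_trans xm (ltW mc)).
by rewrite /= leqNgt ltn_card_below.
Qed.

Lemma lower_cover_above x z : x < z -> exists2 w, cover_rel w z & x <= w.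
Proof.
move=> xz; have /max_elements_above[w] : x \in [set y | y < z] by rewrite inE.
rewrite !inE => /andP[wz /forall_inP w_max] xw; exists w => //.
rewrite /cover_rel wz; apply/forallP => y; apply/negP => /andP[wy yz].
by have := w_max y; rewrite inE yz wy => /(_ isT).
Qed.

Lemma atom_below x : \bot < x -> exists2 a, atom a & a <= x.
Proof.
elim/lt_wf_ind: x => x IH x_gt0; have [?|] := boolP (atom x); first by exists x.
rewrite /atom /cover_rel x_gt0 /= => /forallPn[y]; rewrite negbK => /andP[y0 yx].
by have [a ? ay] := IH y yx y0; exists a => //; apply: le_trans ay (ltW yx).
Qed.

Lemma atom_lt a x : atom a -> x < a -> x = \bot.
Proof.
move=> /andP[_ /forallP/(_ x)]; rewrite lt0x => /[swap] ->.
by rewrite andbT negbK => /eqP.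
Qed.

(** * Coordinates with respect to a building set *)

Lemma factorsP B Y b : b \in factors B Y -> b \in B /\ b <= Y.
Proof. by rewrite !inE => /andP[/andP[-> ->]]. Qed.

Lemma le_factor B Y x : x \in B -> x <= Y -> exists2 b, b \in factors B Y & x <= b.
Proof. by move=> xB xY; apply: max_elements_above; rewrite inE xB. Qed.

Section Building.

Context {B : {set L}} (buildB : building_set B).

Section Family.

Context {Y : L} (Y_gt0 : \bot < Y).

Let idx := {b : L | b \in factors B Y}.

Let family (u : L -> L) (ub : forall b, b \in factors B Y -> u b <= b) :
    factor_product B Y :=
  [ffun b : idx => exist (fun x => x <= val b) (u (val b)) (ub _ (valP b))].

(** The isomorphism of the definition of a building set is only given on the
    families concentrated at one factor.  As every family is the join of such
    families, the isomorphism must be the join map; and comparing a family with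
    one concentrated at b amounts to comparing the entries at b, so a meet with
    b recovers the entry at b. *)
Lemma building_isoE (f : factor_product B Y -> interval_below Y) :
  bijective f ->
  (forall u v, factor_product_le u v <-> val (f u) <= val (f v)) ->
  (forall (u : factor_product B Y) b,
     (forall c, c != b -> val (u c) = \bot) -> val (f u) = val (u b)) ->
  (forall U : factor_product B Y, val (f U) = \join_b val (U b)) /\
  (forall (U : factor_product B Y) b, val (f U) `&` val b = val (U b)).
Proof.
move=> [g _ gK] f_le f_incl.
have single_le (b : idx) t : t <= val b ->
    forall c, c \in factors B Y -> (if c == val b then t else \bot) <= c.
  by move=> tb c _; case: eqP => [->|_]; rewrite ?le0x.
pose single (b : idx) t (tb : t <= val b) : factor_product B Y :=
  family (u := fun c => if c == val b then t else \bot)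
    (single_le b t tb).
have singleE b t tb : val (f (@single b t tb)) = t.
  rewrite (f_incl _ b) ?ffunE /= ?eqxx // => c cb.
  by rewrite ffunE /= val_eqE (negPf cb).
have le_coord (b : idx) t (U : factor_product B Y) :
    t <= val b -> t <= val (f U) <-> t <= val (U b).
  move=> tb; rewrite -{1}(singleE b t tb); split=> [/f_le/(_ b)|tU].
    by rewrite ffunE /= eqxx.
  apply/f_le => c.
  by rewrite ffunE /=; case: eqP => [/val_inj->|_]; rewrite ?le0x.
have U_le (U : factor_product B Y) (b : idx) : val (U b) <= val (f U).
  exact: (le_coord b _ U (valP (U b))).2.
split=> U.
  apply/le_anti/andP; split; last by apply/joinsP => b _.
  have wY : \join_b val (U b) <= Y.
    by apply/joinsP => b _; apply: le_trans (U_le U b) (valP (f U)).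
  pose w : interval_below Y := exist (fun x => x <= Y) _ wY.
  rewrite -[leRHS]/(val w) -(gK w); apply/f_le => b.
  apply: (le_coord b _ (g w) (valP (U b))).1; rewrite gK.
  exact: (joins_sup (fun b => val (U b)) (j := b)).
move=> b; apply/le_anti/andP; split; last by rewrite lexI U_le (valP (U b)).
by apply: (le_coord b _ U (leIr _ _)).1; apply: leIl.
Qed.

Lemma building_join_factors x : x <= Y ->
  x = \join_(b in factors B Y) (x `&` b).
Proof.
move=> xY; have [f [f_bij f_le f_incl]] := buildB.2 Y Y_gt0.
have [fE fI] := building_isoE f_bij f_le f_incl.
have [g _ gK] := f_bij; pose w : interval_below Y := exist (fun x => x <= Y) x xY.
have xE : x = val (f (g w)) by rewrite gK.
apply/le_anti/andP; split; last by apply/joinsP => b _; apply: leIl.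
rewrite [leLHS]xE fE; apply/joinsP => b _; rewrite -fI -xE.
exact: (joins_sup (fun b => x `&` b) (valP b)).
Qed.

Lemma building_meet_join (u : L -> L) b :
  (forall c, c \in factors B Y -> u c <= c) -> b \in factors B Y ->
  (\join_(c in factors B Y) u c) `&` b = u b.
Proof.
move=> uc bF; have [f [f_bij f_le f_incl]] := buildB.2 Y Y_gt0.
have [fE fI] := building_isoE f_bij f_le f_incl.
have := fI (family uc) (exist _ b bF); rewrite ffunE /= => <-; congr (_ `&` _).
rewrite fE; apply/le_anti/andP; split.
  apply/joinsP => c cF; have -> : u c = val (family uc (exist _ c cF)).
    by rewrite ffunE.
  exact: (joins_sup (fun b => val (family uc b))).
apply/joinsP => c _; rewrite ffunE /=.
exact: (joins_sup u (valP c)).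
Qed.

Lemma factors_disjoint b c :
  b \in factors B Y -> c \in factors B Y -> b != c -> b `&` c = \bot.
Proof.
move=> bF cF bc; pose u e := if e == b then b else \bot.
have u_le e : e \in factors B Y -> u e <= e.
  by rewrite /u; case: eqP => [->|_ _]; rewrite ?le0x.
have := building_meet_join u_le cF; rewrite {2}/u eq_sym (negPf bc) => uc.
apply/eqP; rewrite -lex0 -uc leI2 //.
by have := joins_sup u bF; rewrite /u eqxx.
Qed.

(** Coordinates of x that differ from x are below w, so if all of them did, x
    would be below w as their join.  The typical w is the element that x covers
    when there is only one, such as [\bot] when x is an atom. *)
Lemma irreducible_le_factor x w :
  x <= Y -> ~~ (x <= w) -> (forall y, y < x -> y <= w) ->
  exists2 b, b \in factors B Y & x <= b.
Proof.
move=> xY xw w_max; apply/exists_inP; apply: contraNT xw.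
rewrite negb_exists_in => /forall_inP no_b.
rewrite (building_join_factors xY); apply/joinsP => b bF.
by apply: w_max; rewrite lt_neqAle leIl andbT -leEmeet no_b.
Qed.

End Family.

(** Coordinatewise, the join Y of S has b as its coordinate at a factor b, and
    this coordinate is the join of the elements of S below b.  By nestedness
    there is only one of these. *)
Lemma factors_join_sub S :
  S \subset B ->
  (forall T : {set L}, T \subset S -> (1 < #|T|)%N ->
     \join_(x in T) x \notin B) ->
  factors B (\join_(x in S) x) \subset S.
Proof.
set Y := \join_(x in S) x => SB S_nest; apply/subsetP => b bF.
have [bB bY] := factorsP bF; have b_gt0 := buildB.1 b bB.
have Y_gt0 : \bot < Y := lt_le_trans b_gt0 bY.
pose u c := \join_(x in [set x in S | x <= c]) x.
have u_le c : c \in factors B Y -> u c <= c.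
  by move=> _; apply/joinsP => x; rewrite inE => /andP[].
have uE : Y = \join_(c in factors B Y) u c.
  apply/le_anti/andP; split; apply/joinsP.
    move=> x xS.
    have [c cF xc] := le_factor (subsetP SB x xS) (joins_sup id xS).
    apply: le_trans (joins_sup u cF).
    by apply: (@joins_sup _ _ _ x _ id); rewrite inE xS.
  move=> c _; apply/joinsP => x; rewrite inE => /andP[xS _].
  exact: (joins_sup id xS).
have bE : u b = b.
  by rewrite -(building_meet_join Y_gt0 u_le bF) -uE; apply/meet_idPr.
pose T := [set x in S | x <= b]; have uT : u b = \join_(x in T) x by [].
have TS : T \subset S by apply/subsetP => x; rewrite inE => /andP[].
have [T_gt1|T_le1] := ltnP 1 #|T|.
  by have := S_nest T TS T_gt1; rewrite -uT bE bB.
have [/cards0_eq T0|T_gt0] := posnP #|T|.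
  by move: b_gt0; rewrite -bE uT T0 big_set0 ltxx.
have /cards1P[x Tx] : #|T| == 1%N by rewrite eqn_leq T_le1.
by rewrite -bE uT Tx big_set1 (subsetP TS) // Tx inE.
Qed.

(** J lies below one factor of Y, so it misses completely any other factor. *)
Lemma building_missed_atom Y J : Y \notin B -> J \in B -> J <= Y ->
  exists a, [/\ atom a, a <= Y & ~~ (a <= J)].
Proof.
move=> YB JB JY.
have Y_gt0 : \bot < Y := lt_le_trans (buildB.1 J JB) JY.
have [b bF Jb] := le_factor JB JY; have [bB bY] := factorsP bF.
have [c cF cb] : exists2 c, c \in factors B Y & ~~ (c <= b).
  apply/exists_inP; apply: contraNT YB; rewrite negb_exists_in => /forall_inP c_le.
  suff -> : Y = b by [].
  apply/le_anti; rewrite bY andbT (building_join_factors Y_gt0 (lexx Y)).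
  by apply/joinsP => c cF; rewrite leIx2 ?(negbNE (c_le c cF)) ?orbT.
have [cB cY] := factorsP cF; have [a a_atom ac] := atom_below (buildB.1 c cB).
exists a; split=> //; first exact: le_trans ac cY.
have /andP[a_gt0 _] := a_atom; apply: contraL a_gt0 => aJ.
rewrite lt0x negbK -lex0 -(factors_disjoint Y_gt0 bF cF).
  by rewrite lexI ac (le_trans aJ Jb).
by apply: contraNneq cb => ->.
Qed.

End Building.

(** Faces of the nested complex, freed of the elements of [kappa B] that a
    nested set must contain. *)
Lemma nested_complexP B F :
  reflect (F \subset B :\: kappa B /\
           forall S : {set L}, S \subset F -> (1 < #|S|)%N -> antichain S ->
             \join_(x in S) x \notin B)
          (F \in nested_complex B).
Proof.
apply: (iffP imsetP) => [[N + ->]|[FB F_nest]].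
  rewrite inE => /and3P[NB _ /forallP N_nest]; split=> [|S SN S_gt1 S_anti].
    exact: setSD.
  by have /implyP := N_nest S; apply; rewrite SN S_gt1.
have FK : (F :|: kappa B) :\: kappa B = F.
  rewrite setDUl setDv setU0; apply/setDidPl.
  by move: FB; rewrite subsetD => /andP[].
exists (F :|: kappa B) => //; rewrite inE; apply/and3P; split; rewrite ?subsetUr //.
  rewrite subUset (subset_trans FB (subsetDl _ _)) /=.
  by apply/subsetP => x; rewrite inE => /andP[].
by rewrite FK; apply/forallP => S; apply/implyP => /and3P[]; apply: F_nest.
Qed.

Lemma sub_antichain S (T : {set L}) : T \subset S -> antichain S -> antichain T.
Proof.
move=> /subsetP TS /forall_inP S_anti; apply/forall_inP => x /TS/S_anti.
by move=> /forall_inP xS; apply/forall_inP => y /TS/xS.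
Qed.

End FiniteLattice.

(** * Order embeddings *)

Section Embedding.

Context {d d' : Order.disp_t}.
Context {L : finTBLatticeType d} {L' : finTBLatticeType d'}.
Context {phi : L -> L'} (phi_emb : order_embedding phi).

Lemma embedding_le x y : (phi x <= phi y) = (x <= y).
Proof. by apply/idP/idP => /phi_emb. Qed.

Lemma embedding_lt x y : (phi x < phi y) = (x < y).
Proof. by rewrite !lt_leAnge !embedding_le. Qed.

Lemma embedding_inj : injective phi.
Proof. by move=> x y xy; apply/le_anti; rewrite -!embedding_le xy lexx. Qed.

Lemma antichain_imset (S : {set L}) : antichain (phi @: S) -> antichain S.
Proof.
move=> /forall_inP S_anti; apply/forall_inP => x xS; apply/forall_inP => y yS.
have /forall_inP/(_ _ (imset_f phi yS)) := S_anti _ (imset_f phi xS).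
by rewrite (inj_eq embedding_inj) /Order.comparable !embedding_le.
Qed.

Lemma join_preserving_big (S : {set L}) : join_preserving phi -> S != set0 ->
  phi (\join_(x in S) x) <= \join_(x in S) phi x.
Proof.
move=> phiU /set0Pn[x0 x0S]; set J := \join_(x in S) phi x.
have phi0 : phi \bot <= J.
  by apply: le_trans (joins_sup phi x0S); rewrite embedding_le le0x.
elim/big_rec: _ => // x y xS y_le.
by rewrite phiU leUx y_le andbT; apply: joins_sup phi xS.
Qed.

Section Join.

Context {B : {set L}} (buildB : building_set B).
Context {S : {set L}} (S_neq0 : S != set0).

Let Y := \join_(x in S) x.

Context (Y_gt0 : \bot < Y) (factorsS : factors B Y \subset S).

Lemma cover_preserving_big : cover_preserving phi ->
  phi Y <= \join_(x in S) phi x.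
Proof.
set J := \join_(x in S) phi x => phi_cover.
suff: forall Z, Z <= Y -> phi Z <= J by apply.
apply: lt_wf_ind => Z IH ZY; have [->|Z_neq0] := eqVneq Z \bot.
  have /set0Pn[s sS] := S_neq0; apply: le_trans (joins_sup phi sS).
  by rewrite embedding_le le0x.
have [//|ZJ] := boolP (phi Z <= J).
have coverE w : cover_rel w Z -> phi w = phi Z `&` J.
  move=> wZ; have /andP[wZ_lt _] := wZ.
  have w_le : phi w <= phi Z `&` J.
    by rewrite lexI embedding_le (ltW wZ_lt) IH // (le_trans (ltW wZ_lt)).
  have /andP[_ /forallP/(_ (phi Z `&` J))] := phi_cover _ _ wZ.
  rewrite [_ `&` _ < _]lt_neqAle leIl andbT -leEmeet ZJ andbT.
  by rewrite lt_neqAle w_le andbT negbK => /eqP.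
have [|w wZ _] := @lower_cover_above _ L \bot Z; first by rewrite lt0x.
have w_max y : y < Z -> y <= w.
  move=> /lower_cover_above[w1 /coverE w1E yw1].
  by rewrite -embedding_le (coverE w) // -w1E embedding_le.
have [|b bF Zb] := irreducible_le_factor buildB Y_gt0 ZY _ w_max.
  by have /andP[wZ_lt _] := wZ; rewrite lt_geF.
case/negP: ZJ; apply: le_trans _ (joins_sup phi (subsetP factorsS b bF)).
by rewrite embedding_le.
Qed.

Lemma atom_exhaustive_big a : atom_exhaustive phi ->
  atom a -> a <= phi Y -> a <= \join_(x in S) phi x.
Proof.
move=> phi_atom a_atom aY; have [|x xa] := phi_atom a a_atom.
  by apply: le_trans aY _; rewrite embedding_le lex1.
rewrite -xa; have [->|x_neq0] := eqVneq x \bot.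
  have /set0Pn[s sS] := S_neq0; apply: le_trans (joins_sup phi sS).
  by rewrite embedding_le le0x.
(* The image of y lies strictly below the atom phi x, so it is \bot; then y has
   the least image, and y = \bot. *)
have x_min y : y < x -> y <= \bot.
  move=> yx; rewrite -embedding_le (@atom_lt _ _ a (phi y)) ?le0x //.
  by rewrite -xa embedding_lt.
have [||b bF xb] := irreducible_le_factor buildB Y_gt0 _ _ x_min.
- by rewrite -embedding_le xa.
- by rewrite lex0.
apply: le_trans _ (joins_sup phi (subsetP factorsS b bF)).
by rewrite embedding_le.
Qed.

End Join.

End Embedding.

Theorem proposition12p10 (d d' : Order.disp_t)
    (L : finTBLatticeType d) (L' : finTBLatticeType d') (phi : L -> L')
    (B : {set L}) (B' : {set L'})
    (tame_phi : tame phi)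
    (buildB : building_set B) (buildB' : building_set B') :
  (B = phi @^-1: B' <-> B' :&: phi @: [set: L] = phi @: B) /\
  (B = phi @^-1: B' -> compatible phi B B').
Proof.
have [phi_emb phi_tame] := tame_phi; have phi_inj := embedding_inj phi_emb.
split.
  split=> [->|BE]; apply/setP => x.
    apply/setIP/imsetP => [[xB' /imsetP[y _ xE]]|[y yB ->]].
      by exists y; rewrite // inE -xE.
    by rewrite inE in yB; rewrite yB imset_f ?inE.
  by rewrite -(mem_imset _ _ phi_inj) -BE !inE mem_imset // inE andbT.
move=> BE; have phiB x : (phi x \in B') = (x \in B) by rewrite BE inE.
split=> [|F /nested_complexP[/subsetP FB F_nest]].
  by apply/subsetP => _ /imsetP[x xB ->]; rewrite phiB.
apply/nested_complexP; split.
  apply/subsetP => _ /imsetP[x /FB xB ->]; move: xB; rewrite !inE phiB.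
  case/andP=> /[swap] -> /=; rewrite !andbT => /forall_inPn[y yB].
  rewrite negbK => xy; apply/forall_inPn; exists (phi y); first by rewrite phiB.
  by rewrite negbK embedding_lt.
move=> S' S'F; pose S := F :&: phi @^-1: S'.
have SF : S \subset F by apply: subsetIl.
have -> : S' = phi @: S.
  apply/setP => x; apply/idP/imsetP => [xS'|[y + ->]]; last by rewrite !inE => /andP[].
  have /imsetP[y yF xE] := subsetP S'F x xS'.
  by exists y; rewrite // !inE yF -xE.
rewrite card_imset // => S_gt1.
move=> /(antichain_imset phi_emb) S_anti.
rewrite big_imset /=; last by move=> x y _ _ /phi_inj.
have YB := F_nest S SF S_gt1 S_anti.
set Y := \join_(x in S) x in YB; set J := \join_(x in S) phi x.
have SB : S \subset B.
  by apply/subsetP => x /(subsetP SF)/FB; rewrite inE => /andP[].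
have S_neq0 : S != set0 by rewrite -card_gt0 ltnW.
have Y_gt0 : \bot < Y.
  have /set0Pn[s sS] := S_neq0.
  by apply: lt_le_trans (buildB.1 s (subsetP SB s sS)) _; apply: (joins_sup id sS).
have factorsS : factors B Y \subset S.
  apply: factors_join_sub => // T TS T_gt1.
  by apply: F_nest => //; [apply: subset_trans TS SF | apply: sub_antichain TS S_anti].
have JY : J <= phi Y.
  by apply/joinsP => s sS; rewrite embedding_le //; apply: (joins_sup id sS).
have full : phi Y <= J -> J \notin B'.
  by move=> YJ; rewrite (_ : J = phi Y) ?phiB //; apply/le_anti/andP.
case: phi_tame => [phi_atom|phi_join|phi_cover].
- apply/negP => JB'; rewrite -phiB in YB.
  have [a [a_atom aY /negP]] := building_missed_atom buildB' YB JB' JY; apply.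
  exact: (atom_exhaustive_big phi_emb buildB).
- exact/full/join_preserving_big.
- exact/full/(cover_preserving_big phi_emb buildB).
Qed.
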